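(* Let $X$ be any infinite set and let $\alpha,\beta\in\mathcal P_X$. Then the following three conditions are equivalent: (1) $\mathcal P_X=\langle\mathcal E_X\cup\{\alpha,\beta\}\rangle$; (2) $\mathcal P_X=\langle\mathcal E_X\cup\mathcal S_X\cup\{\alpha,\beta\}\rangle$; (3) up to interchanging the names of $\alpha$ and $\beta$ if necessary, $\alpha\in\mathcal L_X$ and $\beta\in\mathcal R_X$ satisfy $s^*(\alpha)=s(\beta)=|X|$.
   Context: Partition monoid: let $X'=\{x':x\in X\}$ be a disjoint copy of the set $X$; for $A\subseteq X$ write $A'=\{a':a\in A\}$. The elements of $\mathcal P_X$ are all set partitions $\alpha$ of $X\cup X'$ into nonempty blocks. Product: given $\alpha,\beta\in\mathcal P_X$, let $X''=\{x'':x\in X\}$ be a third disjoint copy of $X$; relabel each lower vertex $x'$ of (a graph whose connected components are the blocks of) $\alpha$ as $x''$, relabel each upper vertex $x$ of (a graph representing) $\beta$ as $x''$, and take the union of the two graphs on vertex set $X\cup X''\cup X'$. Then $\alpha\beta\in\mathcal P_X$ is the partition in which $u,v\in X\cup X'$ lie in the same block if and only if they are joined by a (finite) path in this graph. This makes $\mathcal P_X$ a monoid with identity $\{\{x,x'\}:x\in X\}$. $\mathcal S_X$ denotes the group of units of $\mathcal P_X$: the partitions all of whose blocks have the form $\{x,y'\}$ with $x,y\in X$. $\mathcal E_X=\{\alpha\in\mathcal P_X:\alpha=\alpha^2\}$ is the set of idempotents. For $T\subseteq\mathcal P_X$, $\langle T\rangle$ is the subsemigroup generated by $T$. $\mathcal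 L_X$ is the set of $\alpha\in\mathcal P_X$ such that every $x\in X$ lies in a block meeting $X'$ and distinct elements of $X$ lie in distinct blocks. $\mathcal R_X$ is the set of $\alpha\in\mathcal P_X$ such that every $x'\in X'$ lies in a block meeting $X$ and distinct elements of $X'$ lie in distinct blocks. Write the blocks of $\alpha\in\mathcal P_X$ as transversal blocks $A_i\cup B_i'$ ($i\in I$) with $A_i,B_i\subseteq X$ nonempty, upper nontransversal blocks $C_j\subseteq X$ ($j\in J$), and lower nontransversal blocks $D_k'\subseteq X'$ ($k\in K$). Put $s(\alpha)=\sum_{i\in I}(|A_i|-1)+\sum_{j\in J}|C_j|$ and $s^*(\alpha)=\sum_{i\in I}(|B_i|-1)+\sum_{k\in K}|D_k|$ (cardinal sums, where $|A|-1$ means the cardinality of $A$ with one element removed). *)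

(* Defs.v *)
From HB Require Import structures.
From Stdlib Require Import Relation_Operators Operators_Properties.
From mathcomp Require Import all_boot.
From mathcomp Require Import boolp classical_sets functions cardinality.

Set Implicit Arguments.
Unset Strict Implicit.
Unset Printing Implicit Defensive.

Local Open Scope classical_set_scope.
Local Open Scope group_scope.

(* The disjoint union of X and its copy X' is the type X + X:
   [inl x] is the upper vertex x and [inr x] is the lower vertex x'. *)
Record part (X : Type) := Part {
  blocks :> set (set (X + X));
  blocksP : partition blocks id [set: X + X]
}.

HB.instance Definition _ (X : Type) := gen_eqMixin (part X).
HB.instance Definition _ (X : Type) := gen_choiceMixin (part X).

Section Classes.
Variables (U : Type) (r : U -> U -> Prop).
Hypotheses (r_refl : forall u, r u u) (r_sym : forall u v, r u v -> r v u)
  (r_trans : forall u v w, r u v -> r v w -> r u w).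

Definition classes : set (set U) := [set [set v | r u v] | u in setT].

Lemma classes_partition : partition classes id [set: U].
Proof.
split.
- apply/seteqP; split=> // u _; exists [set v | r u v] => //=; first by exists u.
- move=> _ _ [u _ <-] [v _ <-] [w [/= uw vw]].
  apply/seteqP; split=> t /= ?.
    exact: r_trans (r_trans vw (r_sym uw)) _.
  exact: r_trans (r_trans uw (r_sym vw)) _.
- by move=> _ [u _ <-]; exists u => /=.
Qed.

End Classes.

Section Product.
Variable X : Type.
Implicit Types (a b c : part X) (u v w : X + X) (B : set (X + X)).

Definition same_block a u v := exists2 B, blocks a B & B u /\ B v.

Inductive vertex := Top of X | Mid of X | Bot of X.

Definition top_mid u := match u with inl x => Top x | inr x => Mid x end.
Definition mid_bot u := match u with inl x => Mid x | inr x => Bot x end.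
Definition top_bot u := match u with inl x => Top x | inr x => Bot x end.

(* Each partition is represented by the graph joining any two vertices of a
   common block; this relation is symmetric, so that its reflexive transitive
   closure is connectedness by a finite path. *)
Inductive product_edge a b : vertex -> vertex -> Prop :=
| EdgeL u v : same_block a u v -> product_edge a b (top_mid u) (top_mid v)
| EdgeR u v : same_block b u v -> product_edge a b (mid_bot u) (mid_bot v).

Definition joined a b u v :=
  clos_refl_trans vertex (product_edge a b) (top_bot u) (top_bot v).

Lemma same_block_refl a u : same_block a u u.
Proof.
have [+ _ _] := blocksP a; move=> /seteqP[_ /(_ u I)] [B aB Bu].
by exists B.
Qed.

Lemma same_block_sym a u v : same_block a u v -> same_block a v u.
Proof. by case=> B aB [Bu Bv]; exists B. Qed.

Lemma same_block_trans a u v w :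
  same_block a u v -> same_block a v w -> same_block a u w.
Proof.
have [_ tr _] := blocksP a.
case=> B aB [Bu Bv] [C aC [Cv Cw]].
have BC : B = C by apply: tr => //; exists v.
by exists B => //; rewrite [in X in _ /\ X]BC.
Qed.

Lemma blocksE a : blocks a = classes (same_block a).
Proof.
have [_ tr ne] := blocksP a.
apply/seteqP; split=> [B aB|_ [u _ <-]].
  have [u Bu] := ne _ aB; exists u => //.
  apply/seteqP; split=> v /= => [|Bv]; last by exists B.
  by case=> C aC [Cu Cv]; have -> : B = C by apply: tr => //; exists u.
have [B aB [Bu _]] := same_block_refl a u.
suff -> : [set v | same_block a u v] = B by [].
apply/seteqP; split=> v /= => [|Bv]; last by exists B.
by case=> C aC [Cu Cv]; have -> : B = C by apply: tr => //; exists u.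
Qed.

Lemma part_ext a b :
  (forall u v, same_block a u v <-> same_block b u v) -> a = b.
Proof.
move=> ab.
have : blocks a = blocks b.
  rewrite !blocksE; congr (classes _).
  by apply/funext => u; apply/funext => v; apply/propext.
case: a {ab} => A pA; case: b => B pB /= AB; case: _ / AB pB => pB.
by congr Part; exact: Prop_irrelevance.
Qed.

Lemma joined_refl a b u : joined a b u u.
Proof. exact: rt_refl. Qed.

Lemma joined_trans a b u v w :
  joined a b u v -> joined a b v w -> joined a b u w.
Proof. exact: rt_trans. Qed.

Lemma product_edge_sym a b p q : product_edge a b p q -> product_edge a b q p.
Proof. by case=> u v /same_block_sym; constructor. Qed.

Lemma joined_sym a b u v : joined a b u v -> joined a b v u.
Proof.
rewrite /joined; elim=> [p q /product_edge_sym|p|p q r _ qp _ rq].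
- exact: rt_step.
- exact: rt_refl.
- exact: rt_trans rq qp.
Qed.

Definition pmul a b : part X :=
  Part (classes_partition (@joined_refl a b) (@joined_sym a b)
    (@joined_trans a b)).

Definition pone_blocks : set (set (X + X)) :=
  [set [set inl x; inr x] | x in setT].

Lemma pone_partition : partition pone_blocks id [set: X + X].
Proof.
split.
- apply/seteqP; split=> // -[] x _;
    by exists [set inl x; inr x]; [exists x | right + left].
- by move=> _ _ [x _ <-] [y _ <-] [_ [[->|->] [[]|[]]]] // ->.
- by move=> _ [x _ <-]; exists (inl x); left.
Qed.

Definition pone : part X := Part pone_partition.

Lemma same_classes (r : X + X -> X + X -> Prop) (rr : forall u, r u u)
    (rs : forall u v, r u v -> r v u)
    (rt : forall u v w, r u v -> r v w -> r u w) u v :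
  same_block (Part (classes_partition rr rs rt)) u v <-> r u v.
Proof.
split=> [[_ /= [w _ <-]] /= [wu wv]|uv].
  exact: rt (rs _ _ wu) wv.
by exists [set v | r u v] => /=; [exists u | split].
Qed.

Lemma same_pmul a b u v : same_block (pmul a b) u v <-> joined a b u v.
Proof. exact: same_classes. Qed.

Definition vert u : X := match u with inl x => x | inr x => x end.

Lemma same_pone u v : same_block pone u v <-> vert u = vert v.
Proof.
split=> [[_ [x _ <-] [[->|->] [->|->]]] //|].
case: u v => x [] y /= <-; exists [set inl x; inr x]; try by exists x.
all: by split; (left + right).
Qed.

Lemma pmul1 a : pmul a pone = a.
Proof.
apply: part_ext => u v; rewrite same_pmul.
pose f p := match p with Top x => inl x | Mid x => inr x | Bot x => inr x end.
have ft w : f (top_bot w) = w by case: w.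
have ft' w : f (top_mid w) = w by case: w.
have fb w : f (mid_bot w) = inr (vert w) by case: w.
split=> [|uv].
  rewrite -{2}[u]ft -{2}[v]ft /joined; elim=> [p q []|p|p q r _ + _].
  - by move=> {}u {}v; rewrite !ft'.
  - move=> {}u {}v /same_pone; rewrite !fb => ->; exact: same_block_refl.
  - exact: same_block_refl.
  - exact: same_block_trans.
have tm w : clos_refl_trans _ (product_edge a pone) (top_bot w) (top_mid w)
         /\ clos_refl_trans _ (product_edge a pone) (top_mid w) (top_bot w).
  case: w => x /=; first by split; exact: rt_refl.
  split; apply: rt_step.
    by apply: (@EdgeR _ _ (inr x) (inl x)); apply/same_pone.
  by apply: (@EdgeR _ _ (inl x) (inr x)); apply/same_pone.
apply: rt_trans (tm u).1 _; apply: rt_trans _ (tm v).2.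
by apply: rt_step; exact: EdgeL.
Qed.

Lemma p1mul a : pmul pone a = a.
Proof.
apply: part_ext => u v; rewrite same_pmul.
pose f p := match p with Top x => inl x | Mid x => inl x | Bot x => inr x end.
have ft w : f (top_bot w) = w by case: w.
have ft' w : f (mid_bot w) = w by case: w.
have fb w : f (top_mid w) = inl (vert w) by case: w.
split=> [|uv].
  rewrite -{2}[u]ft -{2}[v]ft /joined; elim=> [p q []|p|p q r _ + _].
  - move=> {}u {}v /same_pone; rewrite !fb => ->; exact: same_block_refl.
  - by move=> {}u {}v; rewrite !ft'.
  - exact: same_block_refl.
  - exact: same_block_trans.
have tm w : clos_refl_trans _ (product_edge pone a) (top_bot w) (mid_bot w)
         /\ clos_refl_trans _ (product_edge pone a) (mid_bot w) (top_bot w).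
  case: w => x /=; last by split; exact: rt_refl.
  split; apply: rt_step.
    by apply: (@EdgeL _ _ (inl x) (inr x)); apply/same_pone.
  by apply: (@EdgeL _ _ (inr x) (inl x)); apply/same_pone.
apply: rt_trans (tm u).1 _; apply: rt_trans _ (tm v).2.
by apply: rt_step; exact: EdgeR.
Qed.

(* Both bracketings of a triple product are compared with connectedness in a
   graph on four copies of X, indexed by nat. *)
Definition layer i u : nat * X :=
  match u with inl x => (i, x) | inr x => (i.+1, x) end.

Inductive edge3 a b c : nat * X -> nat * X -> Prop :=
| Edge30 u v : same_block a u v -> edge3 a b c (layer 0%N u) (layer 0%N v)
| Edge31 u v : same_block b u v -> edge3 a b c (layer 1%N u) (layer 1%N v)
| Edge32 u v : same_block c u v -> edge3 a b c (layer 2%N u) (layer 2%N v).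

Definition outer3 u : nat * X :=
  match u with inl x => (0%N, x) | inr x => (3%N, x) end.

Lemma rt_map (V W : Type) (E : V -> V -> Prop) (F : W -> W -> Prop)
    (f : V -> W) :
  (forall p q, E p q -> clos_refl_trans _ F (f p) (f q)) ->
  forall p q, clos_refl_trans _ E p q -> clos_refl_trans _ F (f p) (f q).
Proof.
move=> EF p q; elim=> [||{}p {}q r _ + _]; [exact: EF | | exact: rt_trans].
by move=> ?; exact: rt_refl.
Qed.

Lemma collapse (V : Type) (e : vertex -> V) (G : vertex -> vertex -> Prop)
    (H E : V -> V -> Prop) :
  injective e ->
  (forall p q, H p q -> forall x, p <> e (Mid x) /\ q <> e (Mid x)) ->
  (forall p q, E p q ->
    (exists r t, [/\ p = e r, q = e t & G r t]) \/ H p q) ->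
  let E' p q := (exists u v, [/\ p = e (top_bot u), q = e (top_bot v) &
    clos_refl_trans _ G (top_bot u) (top_bot v)]) \/ H p q in
  forall p q, (forall x, p <> e (Mid x)) -> (forall x, q <> e (Mid x)) ->
  clos_refl_trans _ E p q -> clos_refl_trans _ E' p q.
Proof.
move=> ie HM EGH E' s q sM qM sq.
pose inv (w : V) := exists t, [/\ clos_refl_trans _ E' s t,
  forall x, t <> e (Mid x) &
  t = w \/ exists u r, [/\ t = e (top_bot u), w = e r &
                          clos_refl_trans _ G (top_bot u) r]].
have nM r : (forall x, e r <> e (Mid x)) -> exists u, r = top_bot u.
  case: r => x h; [by exists (inl x) | by case: (h x) | by exists (inr x)].
suff : inv q.
  move=> [t [st tM [<- //|[u [r [tu qr ur]]]]]].
  have [|v rv] := nM r; first by rewrite -qr.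
  apply: rt_trans st _; apply: rt_step; left; exists u, v.
  by split => //; rewrite -rv.
elim: {qM sq} (clos_rt_rtn1 _ _ _ _ sq) => [|w z /EGH wz _ [t [st tM tw]]].
  by exists s; split=> //; [exact: rt_refl | left].
case: wz => [[r [r' [wr zr' rr']]]|wz].
  exists t; split=> //; right.
  case: tw => [tw|[u [r2 [tu wr2 ur2]]]].
    have [|u ru] := nM r; first by rewrite -wr -tw.
    by exists u, r'; split; [rewrite tw wr ru | | rewrite -ru; exact: rt_step].
  exists u, r'; split=> //; apply: rt_trans ur2 _; apply: rt_step.
  by have -> : r2 = r by apply: ie; rewrite -wr2.
exists z; split; [|by move=> x; have [] := HM _ _ wz x|by left].
apply: rt_trans st _.
apply: (@rt_trans _ _ _ w); last by apply: rt_step; right.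
case: tw => [->|[u [r2 [tu wr2 ur2]]]]; first exact: rt_refl.
have [|v rv] := nM r2; first by rewrite -wr2 => x; have [] := HM _ _ wz x.
by apply: rt_step; left; exists u, v; rewrite -rv.
Qed.


Lemma joined_mull a b c u v : joined (pmul a b) c u v <->
  clos_refl_trans _ (edge3 a b c) (outer3 u) (outer3 v).
Proof.
pose e p := match p with Top x => (0%N, x) | Mid x => (1%N, x) | Bot x => (2%N, x) end.
have ie : injective e by case=> x [] y //= [->].
split.
  pose f p :=
    match p with Top x => (0%N, x) | Mid x => (2%N, x) | Bot x => (3%N, x) end.
  have fo w : f (top_bot w) = outer3 w by case: w.
  rewrite -!fo; apply: rt_map => _ _ [] {}u {}v.
    have ft w : f (top_mid w) = e (top_bot w) by case: w.
    rewrite same_pmul !ft; apply: rt_map => _ _ [] {}u {}v uv; apply: rt_step.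
      have et w : e (top_mid w) = layer 0%N w by case: w.
      by rewrite !et; exact: Edge30.
    have em w : e (mid_bot w) = layer 1%N w by case: w.
    by rewrite !em; exact: Edge31.
  have fm w : f (mid_bot w) = layer 2%N w by case: w.
  by rewrite !fm => uv; apply: rt_step; exact: Edge32.
pose H p q := exists u v, [/\ p = layer 2%N u, q = layer 2%N v & same_block c u v].
have oM w : forall x, outer3 w <> e (Mid x) by case: w.
move=> uv; rewrite /joined.
pose g (p : nat * X) :=
  match p.1 with 0%N => Top p.2 | 2%N => Mid p.2 | _ => Bot p.2 end.
have go w : g (outer3 w) = top_bot w by case: w.
rewrite -!go.
have {uv} := collapse (G := product_edge a b) (H := H) ie _ _ (oM u) (oM v) uv.
move=> h; apply: rt_map (h _ _) => [_ _ [[p [q [-> -> pq]]]|[p [q [-> -> pq]]]]||].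
- have ge w : g (e (top_bot w)) = top_mid w by case: w.
  by rewrite !ge; apply: rt_step; apply: EdgeL; apply/same_pmul.
- have ge w : g (layer 2%N w) = mid_bot w by case: w.
  by rewrite !ge; apply: rt_step; exact: EdgeR.
- by move=> _ _ [p [q [-> -> _]]] x; case: p q => ? [].
- move=> _ _ [] p q pq; last by right; exists p, q.
    left; exists (top_mid p), (top_mid q).
    by split; [case: p pq | case: q pq | exact: EdgeL].
  left; exists (mid_bot p), (mid_bot q).
  by split; [case: p pq | case: q pq | exact: EdgeR].
Qed.

Lemma joined_mulr a b c u v : joined a (pmul b c) u v <->
  clos_refl_trans _ (edge3 a b c) (outer3 u) (outer3 v).
Proof.
pose e p := match p with Top x => (1%N, x) | Mid x => (2%N, x) | Bot x => (3%N, x) end.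
have ie : injective e by case=> x [] y //= [->].
split.
  pose f p :=
    match p with Top x => (0%N, x) | Mid x => (1%N, x) | Bot x => (3%N, x) end.
  have fo w : f (top_bot w) = outer3 w by case: w.
  rewrite -!fo; apply: rt_map => _ _ [] {}u {}v.
    have fm w : f (top_mid w) = layer 0%N w by case: w.
    by rewrite !fm => uv; apply: rt_step; exact: Edge30.
  have ft w : f (mid_bot w) = e (top_bot w) by case: w.
  rewrite same_pmul !ft; apply: rt_map => _ _ [] {}u {}v uv; apply: rt_step.
    have et w : e (top_mid w) = layer 1%N w by case: w.
    by rewrite !et; exact: Edge31.
  have em w : e (mid_bot w) = layer 2%N w by case: w.
  by rewrite !em; exact: Edge32.
pose H p q := exists u v, [/\ p = layer 0%N u, q = layer 0%N v & same_block a u v].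
have oM w : forall x, outer3 w <> e (Mid x) by case: w.
move=> uv; rewrite /joined.
pose g (p : nat * X) :=
  match p.1 with 0%N => Top p.2 | 1%N => Mid p.2 | _ => Bot p.2 end.
have go w : g (outer3 w) = top_bot w by case: w.
rewrite -!go.
have {uv} := collapse (G := product_edge b c) (H := H) ie _ _ (oM u) (oM v) uv.
move=> h; apply: rt_map (h _ _) => [_ _ [[p [q [-> -> pq]]]|[p [q [-> -> pq]]]]||].
- have ge w : g (e (top_bot w)) = mid_bot w by case: w.
  by rewrite !ge; apply: rt_step; apply: EdgeR; apply/same_pmul.
- have ge w : g (layer 0%N w) = top_mid w by case: w.
  by rewrite !ge; apply: rt_step; exact: EdgeL.
- by move=> _ _ [p [q [-> -> _]]] x; case: p q => ? [].
- move=> _ _ [] p q pq; first by right; exists p, q.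
    left; exists (top_mid p), (top_mid q).
    by split; [case: p pq | case: q pq | exact: EdgeL].
  left; exists (mid_bot p), (mid_bot q).
  by split; [case: p pq | case: q pq | exact: EdgeR].
Qed.

Lemma pmulA : associative pmul.
Proof.
by move=> a b c; apply: part_ext => u v;
  rewrite !same_pmul joined_mull joined_mulr.
Qed.

End Product.

HB.instance Definition _ (X : Type) := isMonoid.Build (part X)
  (@pmulA X) (@p1mul X) (@pmul1 X).

Definition subsemigroup (M : semigroupType) (S : set M) : Prop :=
  forall x y, S x -> S y -> S (x * y).

Definition generated (M : semigroupType) (T : set M) : set M :=
  smallest (@subsemigroup M) T.

Definition idempotents (M : semigroupType) : set M := [set x | x = x * x].

Definition units (M : monoidType) : set M :=
  [set x | exists y, x * y = 1 /\ y * x = 1].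

(* The cardinal |A| - 1 is that of A with a chosen element removed. *)
Definition remove_one (T : Type) (A : set T) : set T :=
  match pselect (A !=set0) with
  | left A0 => A `\ projT1 (cid A0)
  | right _ => set0
  end.

Section Invariants.
Variable X : Type.
Implicit Types (a : part X) (B : set (X + X)).

Definition upper B : set X := [set x | B (inl x)].
Definition lower B : set X := [set x | B (inr x)].

Definition transversals a : set (set (X + X)) :=
  [set B | [/\ blocks a B, upper B !=set0 & lower B !=set0]].
Definition upper_nontransversals a : set (set (X + X)) :=
  [set B | blocks a B /\ lower B = set0].
Definition lower_nontransversals a : set (set (X + X)) :=
  [set B | blocks a B /\ upper B = set0].

(* The cardinal sums defining s and s^* are represented by disjoint unions,
   whose summands are tagged by the block they come from. *)
Definition sing a : set (set (X + X) * X) :=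
  (transversals a `*`` (fun B => remove_one (upper B))) `|`
  (upper_nontransversals a `*`` upper).
Definition cosing a : set (set (X + X) * X) :=
  (transversals a `*`` (fun B => remove_one (lower B))) `|`
  (lower_nontransversals a `*`` lower).

Definition LX : set (part X) := [set a |
  (forall x, exists2 B, blocks a B & upper B x /\ lower B !=set0) /\
  (forall B x y, blocks a B -> upper B x -> upper B y -> x = y)].
Definition RX : set (part X) := [set a |
  (forall x, exists2 B, blocks a B & lower B x /\ upper B !=set0) /\
  (forall B x y, blocks a B -> lower B x -> lower B y -> x = y)].

End Invariants.

Arguments idempotents M : clear implicits.
Arguments units M : clear implicits.
Arguments LX X : clear implicits.
Arguments RX X : clear implicits.

Section Units.
Variable X : Type.
Implicit Types (a b : part X) (u v : X + X).

Definition swap u : X + X := match u with inl x => inr x | inr x => inl x end.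

Definition flip a : part X :=
  Part (classes_partition (r := fun u v => same_block a (swap u) (swap v))
    (fun u => same_block_refl a (swap u))
    (fun u v => @same_block_sym _ a (swap u) (swap v))
    (fun u v w => @same_block_trans _ a (swap u) (swap v) (swap w))).

Lemma same_flip a u v :
  same_block (flip a) u v <-> same_block a (swap u) (swap v).
Proof. exact: same_classes. Qed.

Lemma flipK a : flip (flip a) = a.
Proof.
by apply: part_ext => u v; rewrite !same_flip; case: u => x; case: v.
Qed.

Definition unit_blocks a :=
  forall B, blocks a B -> exists x y, B = [set inl x; inr y].

Lemma unit_blocks_flip a : unit_blocks a -> unit_blocks (flip a).
Proof.
move=> ua _ [u _ <-]; have [B aB [Bu _]] := same_block_refl a (swap u).
have [x [y BE]] := ua _ aB; exists y, x; apply/seteqP; split=> [v /= [C aC [Cu Cv]]|v].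
  have [_ tr _] := blocksP a.
  have CB : C = B by apply: tr => //; exists (swap u).
  move: Cv; rewrite CB BE; case: v => z /= [] // [->]; by [left | right].
by move=> vE; exists B => //; split=> //; rewrite BE; case: vE => ->; [right|left].
Qed.

Lemma pmul_flip a : unit_blocks a -> pmul a (flip a) = @pone X.
Proof.
move=> ua; apply: part_ext => u v; rewrite same_pmul same_pone.
pose f p : X + X :=
  match p with Top x => inl x | Mid x => inr x | Bot x => inl x end.
have fo w : f (top_bot w) = inl (vert w) by case: w.
split=> uv.
  have : same_block a (f (top_bot u)) (f (top_bot v)).
    move: uv; rewrite /joined; elim=> [_ _ []|p|p q r _ + _] => [w z|w z||].
    - have ft t : f (top_mid t) = t by case: t.
      by rewrite !ft.
    - have fb t : f (mid_bot t) = swap t by case: t.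
      by rewrite !fb => /same_flip.
    - exact: same_block_refl.
    - exact: same_block_trans.
  rewrite !fo => -[B aB []]; have [x [y ->]] := ua _ aB.
  by case=> // -[->] [] // [->].
have Tj x : joined a (flip a) (inl x) (inr x).
  have [B aB [Bx _]] := same_block_refl a (inl x).
  have [z [y BE]] := ua _ aB.
  have xy : same_block a (inl x) (inr y) by exists B => //; rewrite BE; split; [rewrite BE in Bx|right].
  apply: (@rt_trans _ _ _ (Mid y)); apply: rt_step; first exact: EdgeL xy.
  by apply: (@EdgeR _ _ _ (inl y) (inr x)); apply/same_flip/same_block_sym.
case: u v uv => x [] y /= ->;
  [exact: joined_refl | exact: Tj | exact/joined_sym/Tj | exact: joined_refl].
Qed.

Lemma pone_total a b : pmul a b = @pone X ->
  (forall x, exists y, same_block a (inl x) (inr y)) /\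
  (forall x y, same_block a (inl x) (inl y) -> x = y).
Proof.
move=> ab; split=> [x|x y xy]; last first.
  have : same_block (@pone X) (inl x) (inl y).
    by rewrite -ab; apply/same_pmul; apply: rt_step; apply: (@EdgeL _ _ _ (inl x) (inl y)).
  by move/same_pone.
have : joined a b (inl x) (inr x) by apply/same_pmul; rewrite ab; exact/same_pone.
rewrite /joined /= => xx.
suff : (exists y, same_block a (inl x) (inr y)) \/
    (exists z, Bot x = Top z /\ same_block a (inl x) (inl z)).
  by case=> // -[z []].
elim: {xx} (clos_rt_rtn1 _ _ _ _ xx) => [|p q pq _ [|[z [pz xz]]]].
- by right; exists x; split=> //; exact: same_block_refl.
- by left.
case: pq pz => -[] // w [] t wt //= [wz]; subst w.
  by right; exists t; split=> //; exact: same_block_trans xz wt.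
by left; exists t; exact: same_block_trans xz wt.
Qed.

Lemma flip_pmul a b : flip (pmul a b) = pmul (flip b) (flip a).
Proof.
pose f (p : vertex X) := match p with Top x => Bot x | Mid x => Mid x | Bot x => Top x end.
have H c d u v : joined c d u v ->
    joined (flip d) (flip c) (swap u) (swap v).
  have fo w : top_bot (swap w) = f (top_bot w) by case: w.
  rewrite /joined !fo; apply: rt_map => _ _ [] {}u {}v uv; apply: rt_step.
    have ft w : f (top_mid w) = mid_bot (swap w) by case: w.
    rewrite !ft; apply: EdgeR; apply/same_flip.
    by case: u v uv => x [].
  have ft w : f (mid_bot w) = top_mid (swap w) by case: w.
  rewrite !ft; apply: EdgeL; apply/same_flip.
  by case: u v uv => x [].
apply: part_ext => u v; rewrite same_flip !same_pmul; split=> /H.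
  by case: u v => x [].
by rewrite !flipK.
Qed.

Lemma flip_pone : flip (@pone X) = @pone X.
Proof.
by apply: part_ext => u v; rewrite same_flip !same_pone; case: u v => x [].
Qed.

Lemma unitsE : units (part X) =
  [set a | forall B, blocks a B -> exists x y, B = [set inl x; inr y]].
Proof.
apply/seteqP; split=> [a [b [ab ba]] B aB|a ua]; last first.
  exists (flip a); split; first exact: pmul_flip.
  by rewrite -{2}[a]flipK; apply: pmul_flip; exact: unit_blocks_flip.
have [up upi] := pone_total ab.
have /pone_total[lo loi] : pmul (flip a) (flip b) = @pone X.
  by rewrite -flip_pmul [pmul b a]ba flip_pone.
have [x [y xy]] : exists x y, B (inl x) /\ B (inr y).
  have [_ tr /(_ _ aB) [u Bu]] := blocksP a.
  case: u Bu => x Bx.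
    have [y [C aC [Cx Cy]]] := up x; exists x, y.
    by have <- : C = B by apply: tr => //; exists (inl x).
  have [y /same_flip /= [C aC [Cx Cy]]] := lo x; exists y, x.
  by have <- : C = B by apply: tr => //; exists (inr x).
exists x, y; apply/seteqP; split=> [[] z Bz|z [->|->]]; [| |exact: xy.1|exact: xy.2].
  by left; congr inl; apply: upi; exists B => //; split=> //; exact: xy.1.
right; congr inr; apply: loi; apply/same_flip.
by exists B => //; split=> //; exact: xy.2.
Qed.

End Units.

(* Main.v *)
From Stdlib Require Import Relation_Operators.
Require Import Defs.
From mathcomp Require Import all_boot.
From mathcomp Require Import boolp classical_sets functions cardinality.

(* The sets [LX] and [RX] consist of the right and of the left invertible
   elements.  If a product is right invertible then so is its first factor, and
   a right invertible idempotent is 1; hence generating everything requires one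
   of [alpha], [beta] in [LX] and the other in [RX], neither a unit.  For the
   cardinals: the elements for which [s < |X|] implies [s^* < |X|] form a
   subsemigroup containing all idempotents, all units and [RX], but [LX]
   contains an element with [s = 0] and [s^* = |X|]; so [s^*(alpha) = |X|], and
   [s(beta) = |X|] follows by turning partitions upside down.

   Conversely, choose [f] and [g] with [x] joined to [(f x)'] in [alpha] and
   [g y] joined to [y'] in [beta].  Any [c] equals [alpha d beta], where [d] has
   a block f(A) + g(B)' for each block A + B' of [c], the remaining vertices
   being singletons.  When the ranges of [f] and [g] are disjoint, [d] is a
   product of two idempotents; in general [d] is a product of three elements of
   this kind, through two further injections whose ranges avoid those of [f] and
   [g] respectively, and each other. *)

Local Open Scope classical_set_scope.
Local Open Scope card_scope.

Set Implicit Arguments.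
Unset Strict Implicit.

(** * Cardinals *)

(** Choice extracts an injection from [r]. Using a relation spares later proofs a function on all of
    [T], which need not exist when [U] is empty. *)
Lemma card_le_rel (T U : Type) (A : set T) (B : set U) (r : T -> U -> Prop) :
  (forall x, A x -> exists2 y, B y & r x y) ->
  (forall x x' y, A x -> A x' -> r x y -> r x' y -> x = x') ->
  A #<= B.
Proof.
move=> rex rinj; have [->|/set0P[a Aa]] := eqVneq A set0; first exact: card_ge0.
have [b _ _] := rex a Aa.
have /choice[f fP] : forall x, exists y, A x -> B y /\ r x y.
  move=> x; have [/rex[y By rxy]|nAx] := pselect (A x); first by exists y.
  by exists b.
have [|F] := (@injfunPex _ _ A B).2 _; last exact: inj_card_le.
exists f => [x /fP[]//|x x' /set_mem Ax /set_mem Ax' fxx'].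
have [_ rx] := fP x Ax; have [_ rx'] := fP x' Ax'.
by apply: rinj rx _ => //; rewrite fxx'.
Qed.

Lemma card_le_fun (T U : Type) (A : set T) (B : set U) :
  A #<= B -> A !=set0 ->
  exists2 f : T -> U, (forall x, A x -> B (f x)) &
    forall x x', A x -> A x' -> f x = f x' -> x = x'.
Proof.
move=> AB [a Aa].
have [b Bb] : B !=set0.
  by apply/set0P/eqP => B0; move: AB; rewrite B0 card_le0 => /eqP A0; rewrite A0 in Aa.
elim/Ppointed: U => U in B AB b Bb *; first by move: Bb; rewrite emptyE.
have /pcard_leP[F] := AB; have [f fA fi] := (injfunPex.1 (squash F)).
exists f => [x /fA//|x x' Ax Ax']; exact: fi (mem_set Ax) (mem_set Ax').
Qed.

(** Zorn's lemma for graphs of injections from subsets of [A] into [B]: a maximal one exhausts [A]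
    or [B], since otherwise one more pair could be added. *)
Lemma card_le_total (T U : Type) (A : set T) (B : set U) : A #<= B \/ B #<= A.
Proof.
pose P (F : set (T * U)) :=
  [/\ forall p, F p -> A p.1 /\ B p.2,
      forall x y y', F (x, y) -> F (x, y') -> y = y' &
      forall x x' y, F (x, y) -> F (x', y) -> x = x'].
have [|F [[FAB Ff Fi] Fmax]] := @Zorn_bigcup _ P.
  move=> C CP Ctot; split=> [p [F /CP[+ _ _] Fp]|x y y'|x x' y].
  - by move=> /(_ _ Fp).
  - move=> [F CF Fxy] [G CG Gxy]; have [FG|GF] := Ctot _ _ CF CG.
      by have [_ h _] := CP _ CG; apply: h (FG _ Fxy) Gxy.
    by have [_ h _] := CP _ CF; apply: h Fxy (GF _ Gxy).
  - move=> [F CF Fxy] [G CG Gxy]; have [FG|GF] := Ctot _ _ CF CG.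
      by have [_ _ h] := CP _ CG; apply: h (FG _ Fxy) Gxy.
    by have [_ _ h] := CP _ CF; apply: h Fxy (GF _ Gxy).
have [Adom|/existsNP[a /not_implyP[Aa aF]]] :=
    pselect (forall x, A x -> exists y, F (x, y)).
  left; apply: (@card_le_rel _ _ _ _ (fun x y => F (x, y))).
    by move=> x /Adom[y Fxy]; exists y => //; have [] := FAB _ Fxy.
  by move=> x x' y _ _; exact: Fi.
have [Bran|/existsNP[b /not_implyP[Bb bF]]] :=
    pselect (forall y, B y -> exists x, F (x, y)).
  right; apply: (@card_le_rel _ _ _ _ (fun y x => F (x, y))).
    by move=> y /Bran[x Fxy]; exists x => //; have [] := FAB _ Fxy.
  by move=> y y' x _ _; exact: Ff.
have [] := Fmax (F `|` [set (a, b)]).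
  split=> [p Fp|FF]; first by left.
  by apply: aF; exists b; apply: FF; right.
split=> [p [/FAB//|->//]|x y y'|x x' y].
- move=> [Fxy|[-> ->]] [Fxy'|[]]; last by [].
  + exact: Ff Fxy Fxy'.
  + by move=> xa; case: aF; exists y; rewrite -xa.
  + by case: aF; exists y'.
- move=> [Fxy|[-> ->]] [Fxy'|[]]; last by [].
  + exact: Fi Fxy Fxy'.
  + by move=> _ yb; case: bF; exists x; rewrite -yb.
  + by case: bF; exists x'.
Qed.

(** Zorn's lemma for graphs [G] of injections from [D * bool] into [D], with [D] inside [B]; the
    last two clauses of [P] give the domain this shape and keep the values in [D]. For a maximal [G]
    the rest of [B] is finite and is absorbed by [D]. *)
Lemma card_double (T : Type) (B : set T) :
  infinite_set B -> B `*` [set: bool] #<= B.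
Proof.
move=> Binf.
pose P (G : set (T * bool * T)) :=
  [/\ forall p, G p -> B p.1.1 /\ B p.2,
      forall b i c c', G (b, i, c) -> G (b, i, c') -> c = c',
      forall q q' c, G (q, c) -> G (q', c) -> q = q',
      forall b i c, G (b, i, c) -> exists d, G (b, ~~ i, d) &
      forall b i c, G (b, i, c) -> exists d, G (c, i, d)].
have [|G [[GB Gf Gi Gn Gc] Gmax]] := @Zorn_bigcup _ P.
  move=> C CP Ctot; split=> [p [F /CP[+ _ _ _ _] Fp]|b i c c'|q q' c|b i c|b i c].
  - by move=> /(_ _ Fp).
  - move=> [F CF Fxy] [G CG Gxy]; have [FG|GF] := Ctot _ _ CF CG.
      by have [_ h _ _ _] := CP _ CG; apply: h (FG _ Fxy) Gxy.
    by have [_ h _ _ _] := CP _ CF; apply: h Fxy (GF _ Gxy).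
  - move=> [F CF Fxy] [G CG Gxy]; have [FG|GF] := Ctot _ _ CF CG.
      by have [_ _ h _ _] := CP _ CG; apply: h (FG _ Fxy) Gxy.
    by have [_ _ h _ _] := CP _ CF; apply: h Fxy (GF _ Gxy).
  - by move=> [F CF /(let: And5 _ _ _ h _ := CP _ CF in h)[d Fd]]; exists d, F.
  - by move=> [F CF /(let: And5 _ _ _ _ h := CP _ CF in h)[d Fd]]; exists d, F.
pose D := [set b | exists i c, G (b, i, c)].
have Dfull b i : D b -> exists c, G (b, i, c).
  case=> j [c Gc']; have [<-|/eqP] := eqVneq j i; first by exists c.
  by case: (Gn _ _ _ Gc') => d; case: i j {Gc'} => -[] Gd // _; exists d.
have DB : D `<=` B by move=> b [i [c /GB[]]].
have BD : finite_set (B `\` D).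
  have [//|/infiniteP /card_le_fun[|e eB ei]] := pselect (finite_set (B `\` D)).
    by exists 0%N.
  have {}ei m n : e m = e n -> m = n by apply: ei.
  have eD n : ~ D (e n) by have [] := eB n I.
  have eR b i n : ~ G (b, i, e n) by move=> /Gc[d Gd]; apply: (eD n); exists i, d.
  (* Were the rest of [B] infinite, a sequence [e] in it could be added to [D] through the bijection
     [(n, i) |-> i + 2 n] from [nat * bool] to [nat]. *)
  pose E := [set p : T * bool * T |
    exists n i, p = (e n, i, e (nat_of_bool i + n.*2)%N)].
  have [] := Gmax (G `|` E).
    split=> [p Gp|GE]; first by left.
    by apply: (eD 0%N); exists true, (e 1%N); apply: GE; right; exists 0%N, true.
  have eE j n : E (e n, j, e (nat_of_bool j + n.*2)%N) by exists n, j.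
  split=> [p [/GB//|[n [i ->]]]|b i c c'|q q' c|b i c|b i c].
  - by split; [case: (eB n I) | case: (eB (nat_of_bool i + n.*2)%N I)].
  - move=> [Gb|[n [j [-> -> ->]]]] [Gb'|[n' [j' []]]].
    + exact: Gf Gb Gb'.
    + by move=> bE; case: (eD n'); rewrite -bE; exists i, c.
    + by case: (eD n); exists j, c'.
    + by move=> /ei <- <- ->.
  - move=> [Gb|[n [j [-> ->]]]] [Gb'|[n' [j' []]]].
    + exact: Gi Gb Gb'.
    + by move=> _ cE; case: q Gb => b i; rewrite cE => /eR.
    + by case: q' Gb' => b i /eR.
    + move=> -> /ei nn'; have jj' : j = j'.
        by have := congr1 odd nn'; rewrite !oddD !odd_double !addbF; case: j j' {nn'} => -[].
      move: nn'; rewrite jj' => /addnI /(congr1 half); rewrite !doubleK.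
      by move=> ->.
  - move=> [/Gn[d Gd]|[n [j [-> -> _]]]]; first by exists d; left.
    by exists (e (nat_of_bool (~~ j) + n.*2)%N); right; exact: eE.
  - move=> [/Gc[d Gd]|[n [j [_ -> ->]]]]; first by exists d; left.
    by eexists; right; exact: eE.
have Dinf : infinite_set D.
  move=> Df; apply: Binf; apply: sub_finite_set (_ : B `<=` D `|` (B `\` D)) _.
    by move=> b Bb; have [Db|nDb] := pselect (D b); [left|right].
  by rewrite finite_setU.
have BDD : B `\` D #<= D.
  have /finite_set_leP[n Dn] := BD; apply: card_le_trans Dn _.
  apply: card_le_trans (card_leT _) _; exact/infiniteP.
have Dd : D `*` [set: bool] #<= D.
  apply: (@card_le_rel _ _ _ _ (fun q c => G (q, c))) => [[b i] [/= Db _]|].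
    have [c Gbc] := Dfull b i Db; exists c => //.
    by have [d Gd] := Gc _ _ _ Gbc; exists i, d.
  by move=> q q' c _ _; exact: Gi.
have BleD : B #<= D.
  apply: card_le_trans Dd.
  have [r rD ri] : exists2 r : T -> T -> Prop,
      forall x, (B `\` D) x -> exists2 y, D y & r x y &
      forall x x' y, (B `\` D) x -> (B `\` D) x' -> r x y -> r x' y -> x = x'.
    have [->|/set0P /(card_le_fun BDD)[f fD fi]] := eqVneq (B `\` D) set0.
      by exists (fun=> xpredT) => x; [case | move=> ? ? []].
    exists (fun x y => y = f x) => [x /fD|x x' y Dx Dx' -> ]; last exact: fi.
    by exists (f x).
  apply: (@card_le_rel _ _ _ _ (fun x q =>
     (D x /\ q = (x, true)) \/ [/\ (B `\` D) x, r x q.1 & q.2 = false])).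
    move=> x Bx; have [Dx|nDx] := pselect (D x).
      by exists (x, true) => //; left.
    by have [|y Dy rxy] := rD x _ => //; exists (y, false) => //; right.
  move=> x x' [y j] _ _ [[Dx [-> ->]]|[/= Dx rx ->]] [[Dx' []]|[]] //= Dx' rx' _.
  exact: ri rx rx'.
apply: card_le_trans (subset_card_le DB).
apply: card_le_trans Dd.
have [f fD fi] := card_le_fun BleD (infinite_setN0 Binf).
apply: (@card_le_rel _ _ _ _ (fun p q => q = (f p.1, p.2))).
  by move=> [b i] [/= /fD Bb _]; exists (f b, i).
by move=> [b i] [b' i'] q [/= Bb _] [/= Bb' _] -> [/fi-> // ->].
Qed.

(** By comparability of cardinals this is |A| < |T|. *)
Definition small (T : Type) (A : set T) := ~ ([set: T] #<= A).

Lemma small_le (T : Type) (A B : set T) : small B -> A #<= B -> small A.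
Proof. by move=> sB AB TA; apply: sB; exact: card_le_trans AB. Qed.

Lemma small_sub (T : Type) (A B : set T) : small B -> A `<=` B -> small A.
Proof. by move=> sB /subset_card_le; exact: small_le. Qed.

Lemma small0 (T : Type) : [set: T] !=set0 -> small (@set0 T).
Proof. by move=> /set0P T0; rewrite /small card_le0 => /eqP T0'; rewrite T0' eqxx in T0. Qed.

(** The larger set [A] decides: if it is finite so is the union, otherwise the union embeds into
    [A * bool], hence into [A]. *)
Lemma small_setU (T : Type) (A B : set T) :
  infinite_set [set: T] -> small A -> small B -> small (A `|` B).
Proof.
move=> Tinf.
wlog BA : A B / B #<= A.
  move=> wh sA sB; have [AB|BA] := card_le_total A B; last exact: wh.
  by rewrite setUC; exact: wh.
move=> sA _.
have [Af|Ainf] := pselect (finite_set A).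
  move=> TAB; apply: Tinf; apply: card_le_finite TAB _.
  by rewrite finite_setU; split=> //; exact: card_le_finite BA Af.
apply: small_le sA _.
apply: card_le_trans (card_double Ainf).
have [B0|/set0P /(card_le_fun BA)[f fA fi]] := eqVneq B set0.
  rewrite B0 setU0.
  apply: (@card_le_rel _ _ _ _ (fun x q => q = (x, true))) => [x Ax|].
    by exists (x, true).
  by move=> x x' _ _ _ -> [].
apply: (@card_le_rel _ _ _ _ (fun x q =>
     (A x /\ q = (x, true)) \/ (B x /\ q = (f x, false)))).
  move=> x [Ax|Bx]; first by exists (x, true) => //; left.
  by exists (f x, false); [split => //; exact: fA|right].
by move=> x x' q _ _ [[Ax ->]|[Bx ->]] [[Ax' []]|[Bx' []]] //; exact: fi.
Qed.

(** If the two ranges share |T| points, two disjoint copies of [T] fit into the intersection.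
    Otherwise [range f] minus [range g] has |T| points, which receive [f1], and [f2] is [g]. *)
Lemma disjoint_injections (T : Type) (f g : T -> T) :
  infinite_set [set: T] -> injective f -> injective g ->
  exists f1 f2 : T -> T, [/\ injective f1, injective f2,
    forall x, range f (f1 x), forall x, range g (f2 x) &
    forall x y, f1 x <> f2 y].
Proof.
move=> Tinf fi gi.
have [sfg|/contrapT fg] := pselect (small (range f `&` range g)); last first.
  have Tb : [set: T] `*` [set: bool] #<= range f `&` range g.
    exact: card_le_trans (card_double Tinf) fg.
  have [|h hfg hi] := card_le_fun Tb.
    by have [t _] := infinite_setN0 Tinf; exists (t, true).
  have {}hi q q' : h q = h q' -> q = q' by apply: hi.
  exists (fun x => h (x, true)), (fun x => h (x, false)); split.
  - by move=> x y /hi[].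
  - by move=> x y /hi[].
  - by move=> x; have [|] := hfg (x, true).
  - by move=> x; have [|] := hfg (x, false).
  - by move=> x y /hi[].
have : ~ small (range f `\` range g).
  move=> sd; have [] := small_setU Tinf sfg sd.
  apply: (@card_le_rel _ _ _ _ (fun x y => y = f x)) => [x _|x x' y _ _ -> /fi //].
  exists (f x) => //; have [|] := pselect (range g (f x)); [left|right]; by split => //; exists x.
move=> /contrapT /card_le_fun[|f1 f1P f1i]; first exact: infinite_setN0.
exists f1, g; split=> //.
- by move=> x y; exact: f1i.
- by move=> x; have [] := f1P x I.
- by move=> x y f1g; have [_ []] := f1P x I; exists y.
Qed.

(** * One-sided units *)

Section Paths.
Variable X : Type.
Implicit Types (a b c : part X) (u v w : X + X).

(** Induction along paths: upper bounds on the blocks of a product are proved below by an invariant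
    [I] that every edge preserves. *)
Lemma joined_inv a b (I : vertex X -> Prop) u v :
  (forall w1 w2, same_block a w1 w2 -> I (top_mid w1) -> I (top_mid w2)) ->
  (forall w1 w2, same_block b w1 w2 -> I (mid_bot w1) -> I (mid_bot w2)) ->
  joined a b u v -> I (top_bot u) -> I (top_bot v).
Proof.
move=> Ia Ib; rewrite /joined; elim=> // [p q [] w1 w2 sw|p q r _ pq _ qr /pq].
- exact: Ia sw.
- exact: Ib sw.
- exact: qr.
Qed.

Lemma joined_top a b x y : same_block a (inl x) (inl y) -> joined a b (inl x) (inl y).
Proof. by move=> xy; apply: rt_step; exact: EdgeL xy. Qed.

Lemma joined_bot a b x y : same_block b (inr x) (inr y) -> joined a b (inr x) (inr y).
Proof. by move=> xy; apply: rt_step; exact: EdgeR xy. Qed.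

Lemma joined_through a b x z y :
  same_block a (inl x) (inr z) -> same_block b (inl z) (inr y) ->
  joined a b (inl x) (inr y).
Proof.
move=> xz zy; apply: (@rt_trans _ _ _ (Mid z)); apply: rt_step.
- exact: EdgeL xz.
- exact: EdgeR zy.
Qed.

Lemma joined_exit a b x y :
  joined a b (inl x) (inr y) -> exists z, same_block a (inl x) (inr z).
Proof.
pose I p := (exists z, same_block a (inl x) (inr z)) \/
  match p with Top x' => same_block a (inl x) (inl x') | _ => False end.
move=> xy; suff : I (top_bot (inr y : X + X)) by case.
apply: (joined_inv (I := I) _ _ xy) => [w1 w2 w12|w1 w2 w12|].
- case=> [xz|]; first by left.
  case: w1 w12 => // x' x'w2 xx'; have := same_block_trans xx' x'w2.
  by case: w2 {x'w2} => z xz; [right | left; exists z].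
- by case=> [xz|]; [left | case: w1 w12].
- by right; exact: same_block_refl.
Qed.

(** [LX] read through [same_block], the form that [pone_total] derives from a right inverse. *)
Definition upper_total a :=
  (forall x, exists y, same_block a (inl x) (inr y)) /\
  (forall x y, same_block a (inl x) (inl y) -> x = y).

Lemma pmul_flip_total a : upper_total a -> pmul a (flip a) = @pone X.
Proof.
move=> [at1 at2]; apply: part_ext => u v; rewrite same_pmul same_pone.
(* The vertices connected to [u]: both outer copies of its underlying point and, in the middle, the
   lower vertices of the block of that point. *)
pose I p := match p with
  Mid z => same_block a (inl (vert u)) (inr z) | Top x | Bot x => vert u = x end.
have Itb w : I (top_bot w) <-> vert u = vert w by case: w.
have Itm w : I (top_mid w) <-> same_block a (inl (vert u)) w.
  by case: w => //= x; split=> [->|/at2//]; exact: same_block_refl.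
have Imb w : I (mid_bot w) <-> same_block a (inl (vert u)) (swap w).
  by case: w => //= x; split=> [->|/at2//]; exact: same_block_refl.
split=> [uv|].
  apply/Itb; apply: (joined_inv (I := I) _ _ uv) => [w1 w2 w12|w1 w2 /same_flip w12|].
  - by rewrite !Itm => /same_block_trans; apply.
  - by rewrite !Imb => /same_block_trans; apply.
  - exact/Itb.
have Tj x : joined a (flip a) (inl x) (inr x).
  have [y xy] := at1 x; apply: (joined_through xy).
  by apply/same_flip; apply: same_block_sym.
case: u v {I Itb Itm Imb} => x [] y /= ->;
  [exact: joined_refl | exact: Tj | exact/joined_sym/Tj | exact: joined_refl].
Qed.

Lemma upper_totalP a : upper_total a <-> exists c, pmul a c = @pone X.
Proof.
split=> [ta|[c ac]]; first by exists (flip a); exact: pmul_flip_total.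
exact: pone_total ac.
Qed.

Lemma LXE a : LX X a <-> upper_total a.
Proof.
have [_ tr _] := blocksP a.
split=> [[at1 at2]|[at1 at2]].
  split=> [x|x y [B aB [Bx By]]]; last exact: at2 aB Bx By.
  by have [B aB [Bx [y By]]] := at1 x; exists y, B.
split=> [x|B x y aB Bx By]; last by apply: at2; exists B.
by have [y [B aB [Bx By]]] := at1 x; exists B => //; split=> //; exists y.
Qed.

Lemma RXE a : RX X a <-> upper_total (flip a).
Proof.
split=> [[at1 at2]|[at1 at2]].
  split=> [x|x y /same_flip[B aB [Bx By]]]; last exact: at2 aB Bx By.
  by have [B aB [Bx [y By]]] := at1 x; exists y; apply/same_flip; exists B.
split=> [x|B x y aB Bx By]; last by apply: at2; apply/same_flip; exists B.
by have [y /same_flip[B aB [Bx By]]] := at1 x; exists B => //; split=> //; exists y.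
Qed.

(** Backwards, the right inverse [b] and the left inverse [flip c] of [a] must coincide. *)
Lemma units_total a : units (part X) a <-> upper_total a /\ upper_total (flip a).
Proof.
split=> [[b [ab ba]]|].
  split; apply/upper_totalP; first by exists b.
  by exists (flip b); rewrite -flip_pmul [pmul b a]ba flip_pone.
move=> [/upper_totalP[b ab] /upper_totalP[c ac]]; exists b; split=> //.
have {ac} ca : pmul (flip c) a = @pone X.
  by rewrite -[a]flipK -flip_pmul ac flip_pone.
change (pmul b a = @pone X).
by rewrite -{1}(p1mul b) -ca -(pmulA _ a b) ab pmul1.
Qed.

Lemma units_flip a : units (part X) a -> units (part X) (flip a).
Proof. by rewrite !units_total flipK => -[]. Qed.

Lemma idempotents_flip a : idempotents (part X) a -> idempotents (part X) (flip a).
Proof.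
move=> aa; change (flip a = pmul (flip a) (flip a)).
by rewrite -flip_pmul; congr flip.
Qed.

(* Right invertibility of [a b] forces that of [a]; if [a] is then a unit, it
   can be cancelled. *)
Lemma nonunit_total_generated (T : set (part X)) (a : part X) :
  generated (idempotents (part X) `|` units (part X) `|` T) a ->
  upper_total a -> ~ units (part X) a ->
  exists2 b, T b & upper_total b /\ ~ units (part X) b.
Proof.
move=> ga ta nua; apply: contrapT => nT; apply: nua; move: ta.
pose Z := [set b : part X | upper_total b -> units (part X) b].
apply: (smallest_sub _ _ ga : Z a) => [b c Zb Zc|b].
  move=> /upper_totalP[d bcd]; rewrite /Z /= in Zb Zc.
  have [b' [bb' b'b]] : units (part X) b.
    by apply/Zb/upper_totalP; exists (pmul c d); rewrite pmulA.
  change (pmul b b' = @pone X) in bb'; change (pmul b' b = @pone X) in b'b.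
  have [c' [cc' c'c]] : units (part X) c.
    (* Conjugation by the unit [b] turns [b c d = 1] into [c d b = 1]. *)
    apply/Zc/upper_totalP; exists (pmul d b).
    rewrite -[LHS]p1mul -b'b -pmulA [pmul b (pmul c _)]pmulA [pmul (pmul b c) _]pmulA.
    by rewrite [pmul (pmul b c) d]bcd p1mul.
  change (pmul c c' = @pone X) in cc'; change (pmul c' c = @pone X) in c'c.
  exists (pmul c' b'); split.
    change (pmul (pmul b c) (pmul c' b') = @pone X).
    by rewrite pmulA -[pmul (pmul b c) c']pmulA cc' pmul1.
  change (pmul (pmul c' b') (pmul b c) = @pone X).
  by rewrite pmulA -[pmul (pmul c' b') b]pmulA b'b pmul1.
case=> [[bb|ub]|Tb] /= => [/upper_totalP[d bd]||tb] //.
  have -> : b = @pone X.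
    by rewrite -bd -[b in LHS]pmul1 -bd pmulA; congr pmul; rewrite -[LHS]bb.
  by exists (@pone X); split; exact: p1mul.
by apply: contrapT => nub; apply: nT; exists b.
Qed.

End Paths.

(** * Defects smaller than the cardinal of X *)

Section Defects.
Variable X : Type.
Hypothesis Xinf : infinite_set [set: X].
Implicit Types (a b : part X) (T : set X).

(* [s^*(a) < |X|], stated without the choice of points made by [cosing]. *)
Definition lower_small a := exists T, [/\ small (~` T),
  forall y, T y -> exists x, same_block a (inl x) (inr y) &
  forall y y', T y -> T y' -> same_block a (inr y) (inr y') -> y = y'].

Definition upper_small a := lower_small (flip a).

Lemma upper_smallP a : upper_small a <-> exists T, [/\ small (~` T),
  forall x, T x -> exists y, same_block a (inl x) (inr y) &
  forall x x', T x -> T x' -> same_block a (inl x) (inl x') -> x = x'].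
Proof.
split=> -[T [sT Tt Ti]]; exists T; split=> //.
- by move=> x /Tt[y /same_flip/same_block_sym]; exists y.
- by move=> x x' Tx Tx' xx'; apply: Ti => //; apply/same_flip.
- by move=> x /Tt[y /same_block_sym]; exists y; apply/same_flip.
- by move=> x x' Tx Tx' /same_flip; exact: Ti.
Qed.

Lemma lower_small_total a : upper_total (flip a) -> lower_small a.
Proof.
move=> [at1 at2]; exists setT; split.
- by rewrite setCT; apply: small0; exact: infinite_setN0.
- by move=> y _; have [x /same_flip/same_block_sym] := at1 y; exists x.
- by move=> y y' _ _ yy'; apply: at2; apply/same_flip.
Qed.

Lemma upper_small_mul a b : upper_small (pmul a b) -> upper_small a.
Proof.
rewrite !upper_smallP => -[T [sT Tt Ti]]; exists T; split=> //.
  by move=> x /Tt[y /same_pmul xy]; exact: joined_exit xy.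
move=> x x' Tx Tx' xx'; apply: Ti => //; apply/same_pmul; exact: joined_top.
Qed.

(* Removes from the lower independent set of [b] the points whose [b]-block
   meets a middle vertex outside the independent set of [a], or a middle vertex
   that is not alone in its [a]-block. *)
Lemma lower_small_mul a b : lower_small a -> lower_small b -> lower_small (pmul a b).
Proof.
move=> [S [sS St Si]] [T [sT Tt Ti]].
pose alone z := S z /\ forall w, same_block a (inr z) (inr w) -> w = z.
exists [set y | T y /\ forall z, same_block b (inl z) (inr y) -> alone z]; split.
(* Both exceptional sets inject into the complement of [S]: a point of [C1] through its middle
   vertex [z], a point of [C2] through the [a]-partner [w] of [z], which lies outside [S] because
   [S] meets no lower part of an [a]-block twice. *)
- pose C1 := [set y | T y /\ exists z, same_block b (inl z) (inr y) /\ ~ S z].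
  pose C2 := [set y | T y /\ exists z w, [/\ same_block b (inl z) (inr y), S z,
    same_block a (inr z) (inr w) & w <> z]].
  have sC1 : small C1.
    apply: small_le sS _.
    apply: (@card_le_rel _ _ _ _ (fun y z => same_block b (inl z) (inr y))).
      by move=> y [_ [z [zy Sz]]]; exists z.
    move=> y y' z [Ty _] [Ty' _] zy zy'; apply: Ti => //.
    exact: same_block_trans (same_block_sym zy) zy'.
  have sC2 : small C2.
    apply: small_le sS _.
    apply: (@card_le_rel _ _ _ _ (fun y w => exists z, [/\ S z,
      same_block b (inl z) (inr y) & same_block a (inr z) (inr w)])).
      move=> y [_ [z [w [zy Sz zw nwz]]]]; exists w; last by exists z.
      by move=> Sw; apply: nwz; apply: Si => //; exact: same_block_sym.
    move=> y y' w [Ty _] [Ty' _] [z [Sz zy zw]] [z' [Sz' zy' zw']].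
    apply: Ti => //; apply: same_block_trans (same_block_sym zy) _.
    have -> // : z = z'.
    by apply: Si => //; exact: same_block_trans zw (same_block_sym zw').
  apply: small_sub (small_setU Xinf sT (small_setU Xinf sC1 sC2)) _ => y /= ny.
  have [Ty|] := pselect (T y); last by left.
  right; have : ~ forall z, same_block b (inl z) (inr y) -> alone z by move=> ?; apply: ny.
  move=> /existsNP[z /not_implyP[zy nz]].
  have [Sz|] := pselect (S z); last by left; split=> //; exists z.
  have : ~ forall w, same_block a (inr z) (inr w) -> w = z by move=> ?; apply: nz.
  by move=> /existsNP[w /not_implyP[zw wz]]; right; split=> //; exists z, w.
- move=> y [/Tt[z zy] /(_ _ zy)[/St[x xz] _]].
  by exists x; apply/same_pmul; exact: joined_through xz zy.
move=> y y' [Ty yP] [Ty' _] /same_pmul yy'; apply: Ti => //; apply: same_block_sym.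
(* The vertices joined to [y]: its middle vertices being alone on the lower side of their
   [a]-blocks, no path from [y] enters another [b]-block. *)
pose I p := match p with
  | Top x => exists z, same_block a (inl x) (inr z) /\ same_block b (inl z) (inr y)
  | Mid z => same_block b (inl z) (inr y)
  | Bot x => same_block b (inr x) (inr y) end.
have Ib w : I (mid_bot w) <-> same_block b w (inr y) by case: w.
have Ia w : I (top_mid w) <->
    exists z, same_block a w (inr z) /\ same_block b (inl z) (inr y).
  case: w => //= w; split=> [wy|[z [wz zy]]].
    by exists w; split=> //; exact: same_block_refl.
  by have [_ zw] := yP _ zy; rewrite (zw w) //; exact: same_block_sym.
apply: (joined_inv (I := I) _ _ yy') => [w1 w2 w12 /Ia[z [zw zy]]|w1 w2 w12 /Ib|].
- by apply/Ia; exists z; split=> //; exact: same_block_trans (same_block_sym w12) zw.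
- by move=> w1y; apply/Ib; exact: same_block_trans (same_block_sym w12) w1y.
- exact: same_block_refl.
Qed.

(** [S1] collects the points of [S] alone on the lower side of their [a]-block and attached to a
    point of [T]; [b] separates them, as otherwise two points of [T] would be joined. A point of
    [S1] without exit in [b] has a vertex outside [S1] in its [b]-block, so there are few of
    these. *)
Lemma upper_small_mul_cancel a b :
  lower_small a -> upper_small (pmul a b) -> upper_small b.
Proof.
move=> [S [sS St Si]] /upper_smallP[T [sT Tt Ti]]; apply/upper_smallP.
pose S1 := [set t | [/\ S t, exists2 x, T x & same_block a (inl x) (inr t) &
  forall w, same_block a (inr t) (inr w) -> w = t]].
have S1b t t' : S1 t -> S1 t' -> same_block b (inl t) (inl t') -> t = t'.
  move=> [St1 [x Tx xt] _] [St2 [x' Tx' xt'] _] tt'; apply: Si => //.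
  apply: same_block_trans (same_block_sym xt) _.
  have -> // : x = x'; apply: Ti => //; apply/same_pmul.
  apply: (@rt_trans _ _ _ (Mid t)); first by apply: rt_step; exact: EdgeL xt.
  apply: (@rt_trans _ _ _ (Mid t')); first by apply: rt_step; exact: EdgeR tt'.
  by apply: rt_step; exact: EdgeL (same_block_sym xt').
have sS1 : small (~` S1).
  pose C1 := [set t | S t /\ ~ exists2 x, T x & same_block a (inl x) (inr t)].
  pose C2 := [set t | S t /\ exists2 w, same_block a (inr t) (inr w) & w <> t].
  have sC1 : small C1.
    apply: small_le sT _.
    apply: (@card_le_rel _ _ _ _ (fun t x => same_block a (inl x) (inr t))).
      move=> t [/St[x xt] nt]; exists x => // Tx; apply: nt; by exists x.
    move=> t t' x [St1 _] [St2 _] xt xt'; apply: Si => //.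
    exact: same_block_trans (same_block_sym xt) xt'.
  have sC2 : small C2.
    apply: small_le sS _.
    apply: (@card_le_rel _ _ _ _ (fun t w => same_block a (inr t) (inr w))).
      move=> t [St1 [w tw nwt]]; exists w => // Sw; apply: nwt; apply: Si => //.
      exact: same_block_sym.
    move=> t t' w [St1 _] [St2 _] tw tw'; apply: Si => //.
    exact: same_block_trans tw (same_block_sym tw').
  apply: small_sub (small_setU Xinf sS (small_setU Xinf sC1 sC2)) _ => t /= nt.
  have [St1|] := pselect (S t); last by left.
  right; have [Tt1|] := pselect (exists2 x, T x & same_block a (inl x) (inr t)); last by left.
  right; split=> //.
  have : ~ forall w, same_block a (inr t) (inr w) -> w = t by move=> ?; apply: nt.
  by move=> /existsNP[w /not_implyP[tw wt]]; exists w.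
exists [set t | S1 t /\ exists y, same_block b (inl t) (inr y)]; split; last 2 first.
- by move=> t [].
- by move=> t t' [St1 _] [St2 _]; exact: S1b.
have sC : small [set t | S1 t /\ ~ exists y, same_block b (inl t) (inr y)].
  apply: small_le sS1 _.
  apply: (@card_le_rel _ _ _ _ (fun t w => same_block b (inl t) (inl w))); last first.
    move=> t t' w [St1 _] [St2 _] tw t'w; apply: S1b => //.
    exact: same_block_trans tw (same_block_sym t'w).
  move=> t [S1t nt]; apply: contrapT => nw.
  have [_ [x Tx xt] tP] := S1t; have [y /same_pmul xy] := Tt _ Tx.
  (* With no exit and no vertex outside [S1] in its [b]-block, [t] is alone there, so a path from
     [x] never gets beyond [t]. *)
  pose I p := match p with
    Top x => same_block a (inl x) (inr t) | Mid z => z = t | Bot _ => False end.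
  have Ia w : I (top_mid w) <-> same_block a w (inr t).
    case: w => //= w; split=> [->|/same_block_sym/tP //]; exact: same_block_refl.
  suff : I (top_bot (inr y : X + X)) by [].
  apply: (joined_inv (I := I) _ _ xy) => [w1 w2 w12 /Ia w1t|[] // w1 w2 w12 /= w1t|//].
    by apply/Ia; exact: same_block_trans (same_block_sym w12) w1t.
  rewrite {}w1t in w12; case: w2 w12 => w /= tw; last by case: nt; exists w.
  have [S1w|nS1w] := pselect (S1 w); first by apply: esym; exact: S1b.
  by case: nw; exists w.
apply: small_sub (small_setU Xinf sS1 sC) _ => t /= nt.
have [S1t|] := pselect (S1 t); last by left.
by right; split=> // yt; apply: nt.
Qed.

(** If [x] in [T] is joined to [z'] with [z] in [T], then [z] has an exit [y'], and [a = a a] joins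
    [x] to [y'], hence to [z], so [x = z]. Thus any [x] in [T] not joined to [x'] is joined to some
    [z'] with [z] outside [T], and [z] determines [x]. *)
Lemma idempotent_small a : idempotents (part X) a -> upper_small a -> lower_small a.
Proof.
move=> aa /upper_smallP[T [sT Tt Ti]].
exists [set x | T x /\ same_block a (inl x) (inr x)]; split; last 2 first.
- by move=> x [_ xx]; exists x.
- move=> x x' [Tx xx] [Tx' xx'] xx1; apply: Ti => //.
  exact: same_block_trans xx (same_block_trans xx1 (same_block_sym xx')).
have sC : small [set x | T x /\ ~ same_block a (inl x) (inr x)].
  apply: small_le sT _.
  apply: (@card_le_rel _ _ _ _ (fun x z => same_block a (inl x) (inr z))); last first.
    move=> x x' z [Tx _] [Tx' _] xz xz'; apply: Ti => //.
    exact: same_block_trans xz (same_block_sym xz').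
  move=> x [Tx nx]; have [z xz] := Tt _ Tx; exists z => // Tz; apply: nx.
  have [y zy] := Tt _ Tz; suff xz1 : x = z by rewrite -xz1 in xz.
  apply: Ti => //; apply: same_block_trans _ (same_block_sym zy).
  change (a = pmul a a) in aa; rewrite aa; apply/same_pmul.
  exact: joined_through xz zy.
apply: small_sub (small_setU Xinf sT sC) _ => x /= nx.
have [Tx|] := pselect (T x); last by left.
by right; split=> // xx; apply: nx.
Qed.

(** In a product [b c], [upper_small] passes to [b]; then [lower_small b] lets it pass to [c], and
    [lower_small] is multiplicative. So [Z] is a subsemigroup. *)
Lemma small_generated (T : set (part X)) (a : part X) :
  generated (idempotents (part X) `|` units (part X) `|` T) a ->
  upper_small a -> ~ lower_small a ->
  exists2 b, T b & ~ lower_small b.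
Proof.
move=> ga ua nla; apply: contrapT => nT; apply: nla; move: ua.
pose Z := [set b | upper_small b -> lower_small b].
apply: (smallest_sub _ _ ga : Z a) => [b c Zb Zc bc|b].
  have lb := Zb (upper_small_mul bc).
  exact: lower_small_mul lb (Zc (upper_small_mul_cancel lb bc)).
case=> [[bb|ub]|Tb] /= sb; first exact: idempotent_small.
- by apply: lower_small_total; have /units_total[] := ub.
- by apply: contrapT => nlb; apply: nT; exists b.
Qed.

End Defects.

(** * The cardinals [s] and [s^*] *)

Section Cosingularity.
Variable X : Type.
Implicit Types (a : part X) (B C : set (X + X)).

Lemma block_eq a B C u v :
  blocks a B -> blocks a C -> B u -> C v -> same_block a u v -> B = C.
Proof.
have [_ tr _] := blocksP a.
move=> aB aC Bu Cv [D aD [Du Dv]].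
have <- : D = B by apply: tr => //; exists u.
by apply: tr => //; exists v.
Qed.

Lemma remove_oneP (T : Type) (A : set T) :
  A !=set0 -> exists2 t, A t & remove_one A = A `\ t.
Proof. by rewrite /remove_one; case: pselect => // A0 _; case: cid => t At; exists t. Qed.

Lemma cosing_block a p : cosing a p -> blocks a p.1 /\ p.1 (inr p.2).
Proof.
case: p => B y [[/= [aB _ B0] By]|[/= [aB _] By]] //; split=> //.
by have [t _ Bt] := remove_oneP B0; move: By; rewrite Bt => -[].
Qed.

Lemma cosing_le a : cosing a #<= [set: X].
Proof.
apply: (@card_le_rel _ _ _ _ (fun p y => y = p.2)) => [p _|]; first by exists p.2.
move=> [B y] [C z] _ /cosing_block[/= aB By] /cosing_block[/= aC Cz] -> yz.
rewrite -yz in Cz *; congr pair.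
exact: block_eq aB aC By Cz (same_block_refl a _).
Qed.

(** The points that [remove_one] deletes from transversal blocks have the separation properties
    asked for in [lower_small], and their complement embeds into [cosing a], which therefore cannot
    be smaller than [X]. *)
Lemma cosing_eq a : ~ lower_small a -> cosing a #= [set: X].
Proof.
move=> nla; apply/card_eqPle; split; first exact: cosing_le.
apply: contrapT => ncos; apply: nla.
exists [set y | exists B,
  [/\ transversals a B, lower B y & ~ remove_one (lower B) y]]; split.
- move=> Xle; apply: ncos; apply: card_le_trans Xle _.
  apply: (@card_le_rel _ _ _ _ (fun y p => y = p.2)); last by move=> y y' p _ _ -> ->.
  move=> y /= ny; have [B aB [By _]] := same_block_refl a (inr y).
  exists (B, y) => //.
  have [B0|/set0P B0] := eqVneq (upper B) set0; first by right.
  have tB : transversals a B by split=> //; exists y.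
  left; split=> //=; apply: contrapT => nr; apply: ny; by exists B.
- by move=> y [B [[aB [x Bx] _] By _]]; exists x, B.
move=> y y' [B [[aB _ B0] By nry]] [B' [[aB' _ _] By' nry']] yy'.
have BB' := block_eq aB aB' By By' yy'; rewrite -BB' in nry' By'.
have [t _ Bt] := remove_oneP B0; rewrite Bt in nry nry'.
have tE z : lower B z -> ~ (lower B `\ t) z -> z = t.
  by move=> Bz nz; apply: contrapT => zt; apply: nz.
by rewrite (tE y) // (tE y').
Qed.

(** [f x] is the very point that [remove_one] deletes from the block of [x], so the points counted
    by [cosing a] avoid the range of [f]. *)
Lemma upper_total_section a : upper_total a -> cosing a #= [set: X] ->
  exists2 f : X -> X, forall x, same_block a (inl x) (inr (f x)) &
    [set: X] #<= ~` range f.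
Proof.
move=> [at1 at2] cosa.
have /choice[f fP] : forall x, exists y, exists B, [/\ blocks a B, B (inl x), B (inr y) &
    remove_one (lower B) = lower B `\ y].
  move=> x; have [y [B aB [Bx By]]] := at1 x.
  have [t Bt BE] : exists2 t, lower B t & remove_one (lower B) = lower B `\ t.
    by apply: remove_oneP; exists y.
  by exists t, B.
exists f => [x|]; first by have [B [aB Bx Bf _]] := fP x; exists B.
have : cosing a #>= [set: X] by move/card_eqPle: cosa => [].
move=> /card_le_trans; apply.
apply: (@card_le_rel _ _ _ _ (fun p y => y = p.2)); last first.
  move=> [B y] [C z] _ /cosing_block[/= aB By] /cosing_block[/= aC Cz] -> yz.
  rewrite -yz in Cz *; congr pair.
  exact: block_eq aB aC By Cz (same_block_refl a _).
move=> [B y] cosB; exists y => // -[x _ fxy].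
have [/= aB By] := cosing_block cosB.
have [C [aC Cx Cf CE]] := fP x.
rewrite fxy in Cf CE.
have BC := block_eq aB aC By Cf (same_block_refl a _).
case: cosB => [[/= _]|[/= [_ B0] _]]; first by rewrite BC CE => -[_ []].
by have : upper B x; [rewrite BC | rewrite B0].
Qed.

Lemma blocks_flip a B : blocks a B -> blocks (flip a) (@swap X @^-1` B).
Proof.
move=> aB; have [_ tr /(_ _ aB)[u Bu]] := blocksP a; rewrite blocksE.
have uK : swap (swap u) = u by case: (u).
exists (swap u) => //; apply/seteqP; split=> v /=.
  move=> /same_flip; rewrite uK => -[C aC [Cu Cv]].
  by have -> : B = C by apply: tr => //; exists u.
by move=> Bv; apply/same_flip; rewrite uK; exists B.
Qed.

Lemma sing_flip a : sing a #= cosing (flip a).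
Proof.
have swapK (B : set (X + X)) : @swap X @^-1` (@swap X @^-1` B) = B.
  by apply/seteqP; split=> -[] x.
apply/card_eqPle; split;
  apply: (@card_le_rel _ _ _ _ (fun p q => q = (@swap X @^-1` p.1, p.2))).
- move=> [B x] [[/= [aB B0 B1] Bx]|[/= [aB B0] Bx]];
    exists (@swap X @^-1` B, x) => //; [left | right]; split=> //=.
  + by split=> //; exact: blocks_flip.
  + by split=> //; exact: blocks_flip.
- by move=> [B x] [C y] q _ _ -> [/(congr1 (fun D => @swap X @^-1` D))]; rewrite !swapK => -> ->.
- move=> [B x] [[/= [/blocks_flip aB B0 B1] Bx]|[/= [/blocks_flip aB B0] Bx]];
    rewrite flipK in aB;
    exists (@swap X @^-1` B, x) => //; [left | right]; split=> //=.
- by move=> [B x] [C y] q _ _ -> [/(congr1 (fun D => @swap X @^-1` D))]; rewrite !swapK => -> ->.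
Qed.

End Cosingularity.

(** * Factorisation *)

Section Labelled.
Variables X K : Type.
Implicit Types (a b : part X) (P Q : X -> option K) (f : X -> X) (h : X -> K).

Definition label P Q (u : X + X) := match u with inl x => P x | inr x => Q x end.

(** A vertex labelled [None] is a block of its own, whence the disjunct [u = v]. *)
Definition labelled_rel P Q u v :=
  u = v \/ exists2 k, label P Q u = Some k & label P Q v = Some k.

Lemma labelled_refl P Q u : labelled_rel P Q u u.
Proof. by left. Qed.

Lemma labelled_sym P Q u v : labelled_rel P Q u v -> labelled_rel P Q v u.
Proof. by case=> [->|[k uk vk]]; [left | right; exists k]. Qed.

Lemma labelled_trans P Q u v w :
  labelled_rel P Q u v -> labelled_rel P Q v w -> labelled_rel P Q u w.
Proof.
case=> [->//|[k uk vk]] [<-|[k' vk' wk']]; right; exists k => //.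
by move: vk; rewrite vk' wk'.
Qed.

Definition labelled P Q : part X :=
  Part (classes_partition (@labelled_refl P Q) (@labelled_sym P Q)
    (@labelled_trans P Q)).

Lemma same_labelled P Q u v :
  same_block (labelled P Q) u v <-> labelled_rel P Q u v.
Proof. exact: same_classes. Qed.

Lemma flip_labelled P Q : flip (labelled P Q) = labelled Q P.
Proof.
apply: part_ext => u v; rewrite same_flip !same_labelled.
have lE w : label P Q (swap w) = label Q P w by case: w.
rewrite /labelled_rel !lE; split=> -[uv|]; [left|by right|left; by rewrite uv|by right].
by case: u v uv => x [] y //= [->].
Qed.

(** The first hypothesis prevents labels from clashing at a middle vertex, so labels are constant
    along paths; the second gives a label present at both top and bottom a middle vertex to pass
    through. *)
Lemma labelled_mul P Q Q' R :
  (forall z k k', Q z = Some k -> Q' z = Some k' -> k = k') ->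
  (forall x z k, P x = Some k -> R z = Some k ->
     exists w, Q w = Some k /\ Q' w = Some k) ->
  pmul (labelled P Q) (labelled Q' R) = labelled P R.
Proof.
move=> QQ' cover; apply: part_ext => u v; rewrite same_pmul same_labelled.
pose att (p : vertex X) k := match p with Top x => P x = Some k
  | Mid z => Q z = Some k \/ Q' z = Some k | Bot x => R x = Some k end.
have attl w k k' : att (top_mid w) k -> label P Q w = Some k' -> k = k'.
  case: w => w /=; first by move=> ->; case.
  by case=> [->|Q'w Qw]; [case | rewrite (QQ' _ _ _ Qw Q'w)].
have attr w k k' : att (mid_bot w) k -> label Q' R w = Some k' -> k = k'.
  case: w => w /=; last by move=> ->; case.
  by case=> [Qw Q'w|->]; [exact: QQ' Qw Q'w | case].
have attlE w k : label P Q w = Some k -> att (top_mid w) k by case: w => //= w; left.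
have attrE w k : label Q' R w = Some k -> att (mid_bot w) k by case: w => //= w; right.
have attE w k : att (top_bot w) k <-> label P R w = Some k by case: w.
split=> [uv|].
  case uk : (label P R u) => [k|].
    right; exists k => //; apply/attE; apply: (joined_inv (I := att^~ k) _ _ uv).
    - move=> w1 w2 /same_labelled[-> //|[k' w1k w2k]] /attl/(_ w1k) ->; exact: attlE.
    - move=> w1 w2 /same_labelled[-> //|[k' w1k w2k]] /attr/(_ w1k) ->; exact: attrE.
    - exact/attE.
  (* An unlabelled outer vertex has no edge except to itself. *)
  left; pose I p := p = top_bot u.
  have : I (top_bot v); last by rewrite /I; case: (u) (v) => x [] y // [->].
  apply: (joined_inv (I := I) _ _ uv) => // w1 w2 /same_labelled[-> //|[k w1k w2k]] w1u.
    by have := attlE _ _ w1k; rewrite /I in w1u; rewrite w1u => /attE; rewrite uk.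
  by have := attrE _ _ w1k; rewrite /I in w1u; rewrite w1u => /attE; rewrite uk.
have top x k z : P x = Some k -> R z = Some k ->
    joined (labelled P Q) (labelled Q' R) (inl x) (inr z).
  move=> Px Rz; have [w [Qw Q'w]] := cover _ _ _ Px Rz.
  by apply: (@joined_through _ _ _ _ w); apply/same_labelled; right; exists k.
case=> [->|[k]]; first exact: joined_refl.
case: u v => x [] y /= xk yk.
- by apply: joined_top; apply/same_labelled; right; exists k.
- exact: top xk yk.
- by apply: joined_sym; exact: top yk xk.
- by apply: joined_bot; apply/same_labelled; right; exists k.
Qed.

(* With [H] the union of the labellings [P] and [Q], both factors of
   [labelled P Q = labelled P H * labelled Q Q] are idempotent. *)
Lemma labelled_disjoint P Q : (forall z k k', P z = Some k -> Q z <> Some k') ->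
  exists d e, [/\ idempotents (part X) d, idempotents (part X) e & labelled P Q = pmul d e].
Proof.
move=> PQ; pose H z := if P z is Some k then Some k else Q z.
exists (labelled P H), (labelled Q Q); split.
- apply/esym/labelled_mul => [z k k'|x z k Px _]; first by rewrite /H; case: (P z) => // l [->] [].
  by exists x; rewrite /H Px.
- by apply/esym/labelled_mul => [z k k' -> []//|x z k Qx _]; exists x.
- apply/esym/labelled_mul => [z k k'|x z k _ Qz].
    rewrite /H; case Pz : (P z) => [l|] Hz Qz; last by move: Qz; rewrite Hz => -[].
    by have := PQ _ _ k' Pz.
  exists z; split=> //; rewrite /H; case Pz : (P z) => [l|//].
  by have := PQ _ _ k Pz.
Qed.

(** The top vertex [x] inherits the label [h x] of [f x]. As [P] labels the range of [f] only, the
    other lower vertices of [a] join nothing further. *)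
Lemma total_mul_labelled a f P Q h : upper_total a ->
  (forall x, same_block a (inl x) (inr (f x))) ->
  (forall x, P (f x) = Some (h x)) -> (forall z k, P z = Some k -> range f z) ->
  pmul a (labelled P Q) = labelled (fun x => Some (h x)) Q.
Proof.
move=> [at1 at2] af Pf Pr; apply: part_ext => u v; rewrite same_pmul same_labelled.
pose P' x := Some (h x).
pose att (p : vertex X) k := match p with Top x => h x = k
  | Mid z => exists x, same_block a (inl x) (inr z) /\ h x = k
  | Bot x => Q x = Some k end.
have atta w k : att (top_mid w) k <-> exists x, same_block a (inl x) w /\ h x = k.
  case: w => // w /=; split=> [<-|[x [/at2 -> //]]].
  by exists w; split=> //; exact: same_block_refl.
have attPQ w k k' : att (mid_bot w) k -> label P Q w = Some k' -> k = k'.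
  case: w => w /=; last by move=> ->; case.
  move=> [x [xw <-]] Pw; have [x' _ fx'] := Pr _ _ Pw.
  move: Pw; rewrite -fx' Pf => -[<-]; congr h; apply: at2.
  by apply: same_block_trans xw _; rewrite -fx'; apply: same_block_sym.
have attE w k : att (top_bot w) k <-> label P' Q w = Some k.
  by case: w => //= w; rewrite /P'; split=> [->|[]].
have attPQE w k : label P Q w = Some k -> att (mid_bot w) k.
  case: w => //= w Pw; have [x _ fx] := Pr _ _ Pw; exists x; split; first by rewrite -fx.
  by move: Pw; rewrite -fx Pf => -[].
split=> [uv|].
  case uk : (label P' Q u) => [k|].
    right; exists k => //; apply/attE; apply: (joined_inv (I := att^~ k) _ _ uv).
    - move=> w1 w2 w12 /atta[x [xw1 hx]]; apply/atta; exists x; split=> //.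
      exact: same_block_trans xw1 w12.
    - move=> w1 w2 /same_labelled[-> //|[k' w1k w2k]] /attPQ/(_ w1k) ->; exact: attPQE.
    - exact/attE.
  left; case: u uk uv => // x /= Qx xv.
  pose I p := p = Bot x.
  have : I (top_bot v); last by rewrite /I; case: (v) => // y [->].
  apply: (joined_inv (I := I) _ _ xv) => // [[] // |w1 w2 /same_labelled[-> //|[k w1k w2k]] w1u].
  by case: w1 w1k w1u => // y /= Qy [yx]; move: Qy; rewrite yx Qx.
have top x k : h x = k -> forall z, Q z = Some k -> joined a (labelled P Q) (inl x) (inr z).
  move=> hx z Qz; apply: joined_through (af x) _.
  by apply/same_labelled; right; exists k => //=; rewrite Pf hx.
case=> [->|[k]]; first exact: joined_refl.
case: u v => x [] y /= => [[xk] [yk]|[xk] yk|xk [yk]|xk yk].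
- apply: (@rt_trans _ _ _ (Mid (f x))); first by apply: rt_step; exact: EdgeL (af x).
  apply: (@rt_trans _ _ _ (Mid (f y))); apply: rt_step.
    apply: (@EdgeR _ _ _ (inl (f x)) (inl (f y))); apply/same_labelled; right.
    by exists k; rewrite /= Pf ?xk ?yk.
  exact: EdgeL (same_block_sym (af y)).
- exact: top xk _ yk.
- by apply: joined_sym; exact: top yk _ xk.
- by apply: joined_bot; apply/same_labelled; right; exists k.
Qed.

(** The labelling [h] transported to the range of [f]; for injective [f] the chosen preimage is the
    only one. *)
Definition along f h z : option K :=
  match pselect (exists x, f x = z) with
  | left fz => Some (h (projT1 (cid fz)))
  | right _ => None
  end.

Lemma along_range f h z k : along f h z = Some k -> exists2 x, f x = z & h x = k.
Proof. by rewrite /along; case: pselect => // fz [<-]; case: cid => x fx; exists x. Qed.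

Lemma alongE f h x : injective f -> along f h (f x) = Some (h x).
Proof.
move=> fi; rewrite /along; case: pselect => [fz|[]]; last by exists x.
by case: cid => y /= /fi ->.
Qed.

Lemma along_disjoint f g h h' : (forall x y, f x <> g y) ->
  forall z k k', along f h z = Some k -> along g h' z <> Some k'.
Proof. by move=> fg z k k' /along_range[x <- _] /along_range[y /esym/fg]. Qed.

End Labelled.

(** * Factoring arbitrary partitions through one-sided units *)

Section Factorisation.
Variable X : Type.
Hypothesis Xinf : infinite_set [set: X].
Implicit Types (a b c : part X) (f g : X -> X).

Definition block_of c (u : X + X) : set (X + X) := [set v | same_block c u v].

Lemma block_ofE c u v : block_of c u = block_of c v <-> same_block c u v.
Proof.
split=> [uv|uv].
  by have : block_of c v v; [exact: same_block_refl | rewrite -uv].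
apply/seteqP; split=> w /=; first exact: same_block_trans (same_block_sym uv).
exact: same_block_trans.
Qed.

(** Blocks serve as their own labels, which brings every partition under the calculus of
    labellings. *)
Lemma labelled_block_of c :
  labelled (fun x => Some (block_of c (inl x))) (fun x => Some (block_of c (inr x))) = c.
Proof.
apply: part_ext => u v; rewrite same_labelled.
have lE w : label (fun x => Some (block_of c (inl x))) (fun x => Some (block_of c (inr x))) w
    = Some (block_of c w) by case: w.
rewrite /labelled_rel !lE; split=> [[->|[k [<-] [] /block_ofE/same_block_sym//]]|/block_ofE uv].
  exact: same_block_refl.
by right; exists (block_of c v) => //; rewrite uv.
Qed.

Lemma section_inj a f : upper_total a ->
  (forall x, same_block a (inl x) (inr (f x))) -> injective f.
Proof.
move=> [_ at2] af x y fxy; apply: at2; apply: same_block_trans (af x) _.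
by rewrite fxy; apply: same_block_sym.
Qed.

Lemma sandwich a b c f g : upper_total a -> upper_total (flip b) ->
  (forall x, same_block a (inl x) (inr (f x))) ->
  (forall x, same_block (flip b) (inl x) (inr (g x))) ->
  pmul (pmul a (labelled (along f (fun x => block_of c (inl x)))
                         (along g (fun x => block_of c (inr x))))) b = c.
Proof.
move=> ta tb af bg.
have mulE (K : Type) d h (h' : X -> K) R :
    upper_total d -> (forall x, same_block d (inl x) (inr (h x))) ->
    pmul d (labelled (along h h') R) = labelled (fun x => Some (h' x)) R :> part X.
  move=> td dh; apply: (total_mul_labelled _ td dh) => [x|z k hz];
    last by have [x <- _] := along_range hz; exists x.
  by apply: alongE; exact: section_inj dh.
(* Once [a] is absorbed, the same rule absorbs [b] with the product turned upside down. *)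
by rewrite mulE // -[LHS]flipK flip_pmul flip_labelled mulE // flip_labelled labelled_block_of.
Qed.

Lemma generated_full a b (T := idempotents (part X) `|` [set a; b]) :
  upper_total a -> upper_total (flip b) ->
  cosing a #= [set: X] -> cosing (flip b) #= [set: X] ->
  generated T = [set: part X].
Proof.
move=> ta tb /(upper_total_section ta)[f af fX] /(upper_total_section tb)[g bg gX].
have fi := section_inj ta af; have gi := section_inj tb bg.
have Tsub : subsemigroup (generated T).
  move=> x y Gx Gy Z ZP; have [Zs _] := ZP; apply: Zs; [exact: Gx ZP | exact: Gy ZP].
have GT x : T x -> generated T x by move=> Tx Z [_ TZ]; exact: TZ.
have disjG (P Q : X -> option (set (X + X))) : (forall z k k', P z = Some k -> Q z <> Some k') ->
    generated T (labelled P Q).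
  move=> /labelled_disjoint[e [e' [ee ee' ->]]].
  by apply: (Tsub); apply: GT; left.
(* [p] and [q] embed [X] into the complements of the ranges of [f] and [g]; [f1] and [f2] inherit
   this. *)
have [p pf pi] := card_le_fun fX (infinite_setN0 Xinf).
have [q qg qi] := card_le_fun gX (infinite_setN0 Xinf).
have {}pi : injective p by move=> x y; exact: pi.
have {}qi : injective q by move=> x y; exact: qi.
have [f1 [f2 [f1i f2i f1p f2q f12]]] := disjoint_injections Xinf pi qi.
apply/seteqP; split=> // c _.
pose hl x := block_of c (inl x); pose hr x := block_of c (inr x).
have chain f' (g' : X -> X) h (R : X -> option (set (X + X))) : injective g' ->
  pmul (labelled (along f' h) (along g' h)) (labelled (along g' h) R) = labelled (along f' h) R.
  move=> gi'; apply: labelled_mul => [z k k' -> []//|x z k hx _].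
  have [y _ <-] := along_range hx; by exists (g' y); rewrite alongE.
rewrite -(sandwich c ta tb af bg).
apply: (Tsub); last by apply: GT; right; right.
apply: (Tsub); first by apply: GT; right; left.
(* Three factors arise, on the pairs [f, f1], then [f1, f2], then [f2, g]; the two ranges in each
   pair are disjoint, so [disjG] applies. *)
rewrite -(@chain f f2) // -(@chain f f1) //.
apply: (Tsub); first apply: (Tsub); apply: disjG; apply: along_disjoint => //.
- by move=> x y fx; have [z _ pz] := f1p y; have [] := pf z I; exists x => //; rewrite pz.
- by move=> x y gy; have [z _ qz] := f2q x; have [] := qg z I; exists y => //; rewrite qz.
Qed.

(** [d] embeds two disjoint copies of [X]: each [x] is joined to the lower vertex [d (x, true)], and
    the |X| lower vertices [d (x, false)] are singletons, which [T] must omit. *)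
Lemma total_not_lower_small : exists a : part X, upper_total a /\ ~ lower_small a.
Proof.
have [|d _ di] := card_le_fun (card_double Xinf).
  by have [x _] := infinite_setN0 Xinf; exists (x, true).
have {}di p q : d p = d q -> p = q by apply: di.
pose i x := d (x, true).
have ii : injective i by move=> x y /di[].
exists (labelled (@Some X) (along i id)); split.
  split=> [x|x y /same_labelled[[]//|[k [->] [->]]//]].
  by exists (i x); apply/same_labelled; right; exists x => //=; rewrite alongE.
move=> [T [sT Tt _]]; apply: sT.
apply: (@card_le_rel _ _ _ _ (fun x y => y = d (x, false))); last by move=> x y z _ _ -> /di[].
move=> x _; exists (d (x, false)) => // /Tt[y /same_labelled[//|[k _ dk]]].
by have [z /di] := along_range dk.
Qed.

End Factorisation.

(** * Equivalence of the three conditions *)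

Lemma generated_flip (X : Type) (alpha beta : part X) :
  [set: part X] =
    generated (idempotents (part X) `|` units (part X) `|` [set alpha; beta]) ->
  [set: part X] =
    generated (idempotents (part X) `|` units (part X) `|` [set flip alpha; flip beta]).
Proof.
move=> full; apply/seteqP; split=> // a _; rewrite -[a]flipK.
have : [set: part X] (flip a) by [].
(* [flip] reverses products and preserves idempotents and units, so the elements whose flip is
   generated form a subsemigroup containing the old generators. *)
rewrite full; move: (flip a); apply: smallest_sub.
  move=> b c Gb Gc; rewrite /= [flip (_ * _)%g]flip_pmul => Z ZP; have [Zs _] := ZP.
  by apply: Zs; [exact: Gc ZP | exact: Gb ZP].
move=> b Tb Z [_]; apply => {Z}.
case: Tb => [[bb|ub]|[->|->]].
- by left; left; exact: idempotents_flip.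
- by left; right; exact: units_flip.
- by right; left.
- by right; right.
Qed.

Lemma full_total (X : Type) (alpha beta : part X) :
  infinite_set [set: X] ->
  [set: part X] =
    generated (idempotents (part X) `|` units (part X) `|` [set alpha; beta]) ->
  (exists2 a, [set alpha; beta] a & upper_total a /\ ~ units (part X) a) /\
  (exists2 a, [set alpha; beta] a & ~ lower_small a).
Proof.
move=> Xinf full; have [a [ta nla]] := total_not_lower_small Xinf.
have : [set: part X] a by [].
rewrite full => ga; split.
  apply: nonunit_total_generated ga ta _ => /units_total[_ tfa].
  by apply: nla; exact: lower_small_total.
apply: small_generated ga _ nla => //.
by apply: lower_small_total => //; rewrite flipK.
Qed.

Unset Implicit Arguments.
Set Strict Implicit.

Theorem theorem36 (X : Type) (Xinf : infinite_set [set: X])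
    (alpha beta : part X) :
  [<-> [set: part X] =
         generated (idempotents (part X) `|` [set alpha; beta]);
       [set: part X] =
         generated (idempotents (part X) `|` units (part X) `|`
                    [set alpha; beta]);
       [/\ LX X alpha, RX X beta, cosing alpha #= [set: X]
         & sing beta #= [set: X]] \/
       [/\ LX X beta, RX X alpha, cosing beta #= [set: X]
         & sing alpha #= [set: X]]].
Proof.
tfae.
- move=> full; apply/seteqP; split=> // a _.
  have : [set: part X] a by [].
  rewrite full; apply: sub_smallest2r => [x y Gx Gy Z ZP|b [eb|ab]].
  + by have [Zs _] := ZP; apply: Zs; [exact: Gx ZP | exact: Gy ZP].
  + by left; left.
  + by right.
- move=> full; have [[a aab [ta nua]] [a' aab' nla]] := full_total Xinf full.
  have [[b bab [tb nub]] [b' bab' nlb]] := full_total Xinf (generated_flip full).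
  have key (c d : part X) : upper_total c -> upper_total (flip d) -> ~ lower_small c ->
      ~ lower_small (flip d) ->
      [/\ LX X c, RX X d, cosing c #= [set: X] & sing d #= [set: X]].
    move=> tc td nlc nld; split; [exact/LXE|exact/RXE|exact: cosing_eq|].
    exact: card_eq_trans (sing_flip d) (cosing_eq nld).
  have small_flip (c : part X) : upper_total c -> lower_small (flip c).
    by move=> tc; apply: (lower_small_total Xinf); rewrite flipK.
  have flip_small (c : part X) : upper_total (flip c) -> lower_small c by exact: lower_small_total.
  have nu (c : part X) : upper_total c -> upper_total (flip c) -> units (part X) c.
    by move=> tc tfc; apply/units_total.
  (* [a] is a right invertible generator and [b] the flip of a left invertible one; if both came
     from the same generator, that would be a unit. *)
  case: aab bab ta nua tb nub => -> [] -> ta nua tb nub.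
  + by case: nua; apply: nu.
  + left; apply: key => //.
      (* The left invertible generator [beta] is [lower_small], so [a'] can only be [alpha]; dually,
         [b'] can only be [flip beta]. *)
      by case: aab' nla => -> // nla; case: nla; exact: flip_small.
    by case: bab' nlb => -> // nlb; case: nlb; exact: small_flip.
  + right; apply: key => //.
      by case: aab' nla => -> // nla; case: nla; exact: flip_small.
    by case: bab' nlb => -> // nlb; case: nlb; exact: small_flip.
  + by case: nua; apply: nu.
- have sing_cosing (c : part X) : sing c #= [set: X] -> cosing (flip c) #= [set: X].
    by rewrite card_eq_sym [in X in _ -> X]card_eq_sym => /card_eq_trans; apply; exact: sing_flip.
  case=> -[/LXE tc /RXE td cc /sing_cosing cd]; symmetry.
    exact: generated_full.
  by rewrite (setUC [set alpha]); exact: generated_full.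
Qed.
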